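(* Let $B$ be an $n\times n$ real symmetric positive semidefinite matrix with rank at least two. Let $(h^{(1)},\dots,h^{(n-1)},t,q)$ be the output of the procedure $\mathrm{sparse2vs\_preprocess}(B)$, and let $S_0$ be the output of the procedure $\mathrm{sparse2vs\_sample}(B,h^{(1)},\dots,h^{(n-1)},t,q)$. Then $S_0$ is a well-defined random variable distributed according to $\mathrm{Vol}_2(B)$.
   Context: Volume sampling: $B_{S\times S}$ denotes the principal submatrix of $B$ with rows and columns indexed by $S\subseteq\{1,\dots,n\}$. A random variable $S_0$ taking values in the 2-element subsets of $\{1,\dots,n\}$ is distributed according to $\mathrm{Vol}_2(B)$ if $\mathbb{P}(S_0=S)=\det(B_{S\times S})/\sum_{S'}\det(B_{S'\times S'})$ for every 2-element subset $S$, where the sum is over all 2-element subsets $S'$ of $\{1,\dots,n\}$. Sparse representation of $B$: for each $1\le i\le n$, let $r_i\geq 0$ be the number of indices $j$ with $i\le j\le n$ and $B_{ij}\neq 0$; let $i\le j^{(i)}_1<\dots<j^{(i)}_{r_i}\le n$ be these indices in increasing order, let $v^{(i)}_k := B_{i j^{(i)}_k}$ for $1\le k\le r_i$, and let $j^{(i)}_{r_i+1}:=n+1$. If $r_i=0$, use the convention $v^{(i)}_1:=0$. (Since $B$ is positive semidefinite, $r_i\ge1$ implies $B_{ii}\neq 0$, so $j^{(i)}_1=i$; and $r_i=0$ exactly when $B_{ii}=0$. Hence $v^{(i)}_1=B_{ii}$ for all $i$.) For given $h=(h^{(1)},\dots,h^{(n-1)})$ with $h^{(i)}\in\mathbb{R}^{r_i}$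 and $t\in\mathbb{R}^{n+1}$, define for $1\le i\le n-1$, $i\le j\le n$, $1\le k\le r_i$ $$P_{v,h,t}(i,j,k) := v^{(i)}_1(t_i-t_{j+1})-h^{(i)}_k,$$ with the convention $P_{v,h,t}(i,n,r_i):=0$ when $r_i=0$. Procedure $\mathrm{sparse2vs\_preprocess}(B)$: (1) for each $1\le i\le n-1$, compute $h^{(i)}\in\mathbb{R}^{r_i}$ with $h^{(i)}_k:=\sum_{k'=1}^k (v^{(i)}_{k'})^2$; (2) compute $t\in\mathbb{R}^{n+1}$ with $t_i:=\sum_{j=i}^n v^{(j)}_1$ for $1\le i\le n$ and $t_{n+1}:=0$; (3) compute $q\in\mathbb{R}^{n-1}$ with $q_i:=\sum_{i'=1}^i P_{v,h,t}(i',n,r_{i'})$; return $(h^{(1)},\dots,h^{(n-1)},t,q)$. Procedure $\mathrm{sparse2vs\_sample}(B,h^{(1)},\dots,h^{(n-1)},t,q)$: (1) generate independent random $u_1,u_2$ uniformly distributed on $(0,1)$; (2) find $i_0:=\min\{1\le i\le n-1 : u_1\le q_i/q_{n-1}\}$ (by binary search); (3) find $k_l:=\min\{1\le k\le r_{i_0} : u_2\le P_{v,h,t}(i_0,j^{(i_0)}_{k+1}-1,k)/P_{v,h,t}(i_0,n,r_{i_0})\}$ (by binary search); (4) find $j_0:=\min\{j^{(i_0)}_{k_l}\le j\le j^{(i_0)}_{k_l+1}-1 : u_2\le P_{v,h,t}(i_0,j,k_l)/P_{v,h,t}(i_0,n,r_{i_0})\}$ (by binary search); return $\{i_0,j_0\}$.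 *)

(* Defs.v *)
From mathcomp Require Import all_boot all_order all_algebra.
From mathcomp Require Import all_classical all_reals all_analysis.

Set Implicit Arguments.
Unset Strict Implicit.
Unset Printing Implicit Defensive.

Import Order.TTheory GRing.Theory Num.Theory.

Local Open Scope ring_scope.

(* All indices are 0-based: rows and columns run over 0, ..., n-1, positions in
   a sparse row over 0, ..., r_i - 1, and the sentinel column is n. *)

Section LinearAlgebra.
Variables (R : realFieldType) (n : nat).
Implicit Types (B : 'M[R]_n) (S : {set 'I_n}).

Definition psdmx B : Prop := forall x : 'rV[R]_n, 0 <= (x *m B *m x^T) 0 0.

Definition principal_submx B S : 'M[R]_#|S| :=
  mxsub (fun a : 'I_#|S| => enum_val a) (fun a : 'I_#|S| => enum_val a) B.

Definition vol2 B S : R :=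
  \det (principal_submx B S) /
  \sum_(S' : {set 'I_n} | #|S'| == 2) \det (principal_submx B S').

End LinearAlgebra.

Section Sparse2VS.
Variables (R : realFieldType) (n : nat).
Implicit Types (B : 'M[R]_n) (i : 'I_n).

Definition sp_cols B i : seq 'I_n :=
  [seq j : 'I_n <- enum 'I_n | (i <= j)%N & B i j != 0].

Definition sp_size B i : nat := size (sp_cols B i).

(* The default value provides the sentinel: sp_col B i (sp_size B i) = n. *)
Definition sp_col B i (k : nat) : nat :=
  nth n [seq nat_of_ord j | j <- sp_cols B i] k.

(* The default value provides the convention for an empty row: its entry at
   position 0 is 0. *)
Definition sp_val B i (k : nat) : R := nth 0 [seq B i j | j <- sp_cols B i] k.

Definition sp_P B (h : seq (seq R)) (t : seq R) i (j k : nat) : R :=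
  if sp_size B i == 0%N then 0
  else sp_val B i 0 * (t`_i - t`_j.+1) - (nth [::] h i)`_k.

(* P(i, last column, last position of row i) *)
Definition sp_P_last B (h : seq (seq R)) (t : seq R) i : R :=
  sp_P B h t i n.-1 (sp_size B i).-1.

Definition sparse2vs_preprocess B : seq (seq R) * seq R * seq R :=
  let h := [seq [seq \sum_(k' < k.+1) sp_val B i k' ^+ 2 | k <- iota 0 (sp_size B i)]
           | i : 'I_n <- enum 'I_n & (i.+1 < n)%N] in
  let t := rcons [seq \sum_(j < n | (i <= j)%N) sp_val B j 0 | i <- enum 'I_n] 0 in
  let q := [seq \sum_(i' < n | (i' <= i)%N) sp_P_last B h t i'
           | i : 'I_n <- enum 'I_n & (i.+1 < n)%N] in
  (h, t, q).

(* The minimum of {a | p a}, or None if this set is empty; enum 'I_m lists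
   'I_m in increasing order. *)
Definition ord_min (m : nat) (p : pred 'I_m) : option 'I_m :=
  ohead [seq a <- enum 'I_m | p a].

(* None records a failed run: a division by zero or the minimum of an empty
   set. *)
Definition sparse2vs_sample B (h : seq (seq R)) (t q : seq R) (u1 u2 : R) :
    option {set 'I_n} :=
  let qlast := q`_n.-2 in
  if qlast == 0 then None else
  if ord_min (fun i : 'I_n => (i.+1 < n)%N && (u1 <= q`_i / qlast)) is Some i0 then
    let Plast := sp_P_last B h t i0 in
    if Plast == 0 then None else
    if ord_min (fun k : 'I_(sp_size B i0) =>
         u2 <= sp_P B h t i0 (sp_col B i0 k.+1).-1 k / Plast) is Some kl then
      if ord_min (fun j : 'I_n => (sp_col B i0 kl <= j < sp_col B i0 kl.+1)%N &&
           (u2 <= sp_P B h t i0 j kl / Plast)) is Some j0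
      then Some [set i0; j0]
      else None
    else None
  else None.

End Sparse2VS.

Section Probability.
Context {d : measure_display} {Omega : measurableType d} {R : realType}.
Variable Pr : probability Omega R.
Local Open Scope classical_set_scope.
Local Open Scope ereal_scope.

(* The endpoints are null sets, so [0, 1] and (0, 1) carry the same uniform
   law. *)
Definition uniform01 (u : {RV Pr >-> R}) : Prop :=
  forall A : set R, measurable A -> distribution Pr u A = uniform_prob (@ltr01 R) A.

Definition independent2 (u1 u2 : {RV Pr >-> R}) : Prop :=
  forall A1 A2 : set R, measurable A1 -> measurable A2 ->
    Pr (u1 @^-1` A1 `&` u2 @^-1` A2) = Pr (u1 @^-1` A1) * Pr (u2 @^-1` A2).

End Probability.

(* Main.v *)
Require Import Defs.
From mathcomp Require Import all_boot all_order all_algebra.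
From mathcomp Require Import all_classical all_reals all_analysis.
From mathcomp Require Import measurable_realfun.
From mathcomp Require Import ring lra zify.

(* For i < j put w(i,j) = B_ii B_jj - B_ij^2, the determinant of the principal
   submatrix on {i, j}. Whenever P(i,j,k) is evaluated with j in the k-th gap of
   row i, its value is the partial sum of w(i,j') over j' <= j: the part with t
   contributes B_ii B_j'j', and h contributes B_ij'^2 since the entries of the
   row up to column j are exactly the first k stored ones. Hence i_0 is sampled
   by inverting the distribution function of the row sums of w, and the two
   searches for k_l and j_0 together invert that of row i_0 of w, so that {a, b}
   is returned with probability proportional to w(a,b). The rank assumption is
   what makes the total weight positive: a positive semidefinite matrix all of
   whose 2x2 principal minors vanish has rank at most one, because its quadratic
   form vanishes at e_j - (B_ij / B_ii) e_i, which therefore lies in the kernel. *)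

Set Implicit Arguments.
Unset Strict Implicit.
Unset Printing Implicit Defensive.

Import Order.TTheory GRing.Theory Num.Theory.

Local Open Scope ring_scope.

(** * Principal 2x2 minors of positive semidefinite matrices *)

Section PsdMinors.
Variables (R : realFieldType) (n : nat) (B : 'M[R]_n).
Hypotheses (Btr : B^T = B) (Bpsd : psdmx B).
Implicit Types (x y : 'rV[R]_n) (i j : 'I_n).

Definition minor2 i j : R := B i i * B j j - B i j ^+ 2.

Lemma sym_entry i j : B i j = B j i.
Proof. by rewrite -[in LHS]Btr mxE. Qed.

Lemma form_sym x y : (x *m B *m y^T) 0 0 = (y *m B *m x^T) 0 0.
Proof.
have -> : x *m B *m y^T = (y *m B *m x^T)^T.
  by rewrite !trmx_mul trmxK Btr mulmxA.
by rewrite mxE.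
Qed.

Lemma form_delta i j :
  ((delta_mx 0 i : 'rV[R]_n) *m B *m (delta_mx 0 j : 'rV[R]_n)^T) 0 0 = B i j.
Proof. by rewrite -rowE trmx_delta -colE !mxE. Qed.

Lemma form_lin (a : R) x y :
  ((a *: x + y) *m B *m (a *: x + y)^T) 0 0 =
  a ^+ 2 * (x *m B *m x^T) 0 0 + a * (x *m B *m y^T) 0 0 *+ 2
  + (y *m B *m y^T) 0 0.
Proof.
rewrite linearD linearZ /= !mulmxDl !mulmxDr -!scalemxAl -!scalemxAr.
have addE (M N : 'M[R]_1) : (M + N) 0 0 = M 0 0 + N 0 0 by rewrite mxE.
have scaleE (c : R) (M : 'M[R]_1) : (c *: M) 0 0 = c * M 0 0 by rewrite mxE.
rewrite !(addE, scaleE) (form_sym y x).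
by ring.
Qed.

(* A nonnegative quadratic form vanishing at x cannot have a nonzero cross term. *)
Lemma psd_kernel x : (x *m B *m x^T) 0 0 = 0 -> x *m B = 0.
Proof.
move=> Qx; have cross y : (x *m B *m y^T) 0 0 = 0.
  set c := (X in X = 0); apply/eqP/negPn/negP => c0.
  set b := (y *m B *m y^T) 0 0.
  (* The coefficient makes the cross term equal to [- (b + 1)], so the form takes the value -1,
     which is impossible. *)
  have := Bpsd ((- (b + 1) / (c *+ 2)) *: x + y).
  rewrite form_lin Qx -/c -/b mulr0 add0r.
  have -> : - (b + 1) / (c *+ 2) * c *+ 2 = - (b + 1).
    by field.
  lra.
apply/rowP => j; have := cross (delta_mx 0 j).
by rewrite trmx_delta -colE !mxE.
Qed.

Lemma psd_diag_ge0 i : 0 <= B i i.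
Proof. by have := Bpsd (delta_mx 0 i); rewrite form_delta. Qed.

Lemma psd_diag_eq0 i j : B i i = 0 -> B i j = 0.
Proof.
rewrite -[LHS]form_delta => /psd_kernel.
by rewrite -rowE => /rowP/(_ j); rewrite !mxE.
Qed.

(** The coefficient of [delta_mx 0 i] minimises the form along that direction; the minimum is the
    Schur complement of [B i i] in the block on i and j. *)
Lemma form_schur i j : B i i != 0 ->
  let x : 'rV[R]_n := - (B i j / B i i) *: delta_mx 0 i + delta_mx 0 j in
  (x *m B *m x^T) 0 0 = minor2 i j / B i i.
Proof. by move=> Bii /=; rewrite form_lin !form_delta /minor2; field. Qed.

Lemma minor2_ge0 i j : 0 <= minor2 i j.
Proof.
have [Bii|Bii] := eqVneq (B i i) 0.
  by rewrite /minor2 (psd_diag_eq0 j Bii) Bii mul0r expr0n subrr.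
have Bii_gt0 : 0 < B i i by rewrite lt0r Bii psd_diag_ge0.
have := Bpsd (- (B i j / B i i) *: delta_mx 0 i + delta_mx 0 j).
by rewrite form_schur // pmulr_lge0 // invr_gt0.
Qed.

Lemma minor2C i j : minor2 i j = minor2 j i.
Proof. by rewrite /minor2 [B i j]sym_entry mulrC. Qed.

Lemma minor2_diag i : minor2 i i = 0.
Proof. by rewrite /minor2; ring. Qed.

Lemma minor2_eq0_row i j : B i i != 0 -> minor2 i j = 0 ->
  row j B = (B i j / B i i) *: row i B.
Proof.
move=> Bii m0; have := form_schur j Bii; rewrite m0 mul0r => /psd_kernel.
rewrite mulmxDl -scalemxAl -!rowE scaleNr addrC => /eqP.
by rewrite subr_eq0 => /eqP.
Qed.

Lemma psd_rank2_minor : (2 <= \rank B)%N -> exists i j, minor2 i j != 0.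
Proof.
move=> rkB; suff /existsP[i /existsP[j ij]] : [exists i, exists j, minor2 i j != 0].
  by exists i, j.
apply: contraLR rkB; rewrite negb_exists -ltnNge ltnS => /forallP H.
have m0 i j : minor2 i j = 0.
  by have := H i; apply: contraNeq => mij; apply/existsP; exists j.
have [i Bii|B0] := pickP (fun i => B i i != 0).
  (* Every row is a multiple of row i, so [B] is a column times a row. *)
  suff -> : B = (\col_j (B i j / B i i)) *m row i B.
    by rewrite (leq_trans (mxrankM_maxl _ _)) ?rank_leq_col.
  apply/row_matrixP => j; rewrite (minor2_eq0_row Bii (m0 i j)) row_mul.
  by apply/rowP => k; rewrite !mxE big_ord1 !mxE.
suff -> : B = 0 by rewrite mxrank0.
apply/matrixP => i j; rewrite mxE; apply: psd_diag_eq0.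
by apply/eqP/negbFE/B0.
Qed.

End PsdMinors.

(** * Two-element principal minors and sums over increasing pairs *)

Section Principal.
Variables (R : realFieldType) (n : nat) (B : 'M[R]_n).

(** The size [m] is a variable because [#|S|] is only provably equal to 2. The enumeration [f] may
    list i and j in either order; symmetry gives both orders the same determinant. *)
Lemma det_mxsub2 m (f : 'I_m -> 'I_n) (i j : 'I_n) : m = 2%N -> injective f ->
  (forall a, f a \in [set i; j]) -> B i j = B j i ->
  \det (mxsub f f B) = minor2 B i j.
Proof.
move=> m2; move: f; rewrite m2 => f f_inj fP Bij.
have := fP 0; have := fP 1; rewrite !inE.
have : f 0 != f 1 by rewrite (inj_eq f_inj).
rewrite (expand_det_row _ 0) !big_ord_recl big_ord0 /cofactor !det_mx11 !mxE /minor2 /=.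
rewrite !expr1 !expr0.
have -> : lift ord0 (ord0 : 'I_1) = 1 :> 'I_2 by apply/val_inj.
have -> : lift 1 (0 : 'I_1) = 0 :> 'I_2 by apply/val_inj.
rewrite [f ord0](_ : _ = f 0) //.

by move=> f01 /orP[] /eqP E1 /orP[] /eqP E0; move: f01;
   rewrite ?E0 ?E1 ?eqxx // => _; rewrite ?Bij; ring.
Qed.

Lemma det_principal2 (i j : 'I_n) : B i j = B j i -> i != j ->
  \det (principal_submx B [set i; j]) = minor2 B i j.
Proof.
move=> Bij ij; apply: det_mxsub2 => //; first by rewrite cards2 ij.
- exact: enum_val_inj.
- exact: enum_valP.
Qed.

Lemma set2_lt_inj (p p' : 'I_n * 'I_n) : (p.1 < p.2)%N -> (p'.1 < p'.2)%N ->
  [set p.1; p.2] = [set p'.1; p'.2] -> p = p'.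
Proof.
case: p p' => [a b] [c d] /= ab cd /setP E.
have := E a; have := E b; rewrite !inE !eqxx orbT /=.
move=> /esym /orP[] /eqP eb /esym /orP[] /eqP ea; subst => //.
- by rewrite ltnn in ab.
- by have := ltn_trans ab cd; rewrite ltnn.
- by rewrite ltnn in ab.
Qed.

Lemma card2_lt (S : {set 'I_n}) : #|S| = 2%N ->
  exists i j : 'I_n, (i < j)%N /\ S = [set i; j].
Proof.
move/eqP/cards2P => [i [j [ij ->]]].
move: ij; rewrite neq_ltn => /orP[] h; first by exists i, j.
by exists j, i; rewrite finset.setUC.
Qed.

(** Increasing pairs represent the two-element sets: [set2_lt_inj] gives injectivity and [card2_lt]
    surjectivity of the reindexing. *)
Lemma sum_card2 (F : {set 'I_n} -> R) :
  \sum_(S : {set 'I_n} | #|S| == 2) F S =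
  \sum_(i < n) \sum_(j < n | (i < j)%N) F [set i; j].
Proof.
pose A := [set p : 'I_n * 'I_n | (p.1 < p.2)%N].
pose g (p : 'I_n * 'I_n) := [set p.1; p.2].
rewrite pair_big_dep /=.
transitivity (\sum_(p in A) F (g p)); last by apply: eq_bigl => p; rewrite inE.
rewrite -(big_imset (A := A) F (h := g)) /=; last first.
  by move=> p p'; rewrite !inE => hp hp'; apply: set2_lt_inj.
apply: eq_bigl => S; apply/eqP/imsetP => [/card2_lt[i [j [ij ->]]]|[p]].
  by exists (i, j); rewrite ?inE.
by rewrite inE => pp ->; rewrite cards2 neq_ltn pp.
Qed.
End Principal.

(** * Sparse rows *)

(** The filter drops only the last ordinal, so no earlier position shifts. This is how entries of
    [h] and [q] are read. *)
Lemma nth_enum_belast (T : Type) (x0 : T) n (f : 'I_n -> T) (i : 'I_n) :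
  (i.+1 < n)%N -> nth x0 [seq f a | a : 'I_n <- enum 'I_n & (a.+1 < n)%N] i = f i.
Proof.
case: n f i => [|n] f i hi; first by case: (i).
have E : [seq val a | a : 'I_n.+1 <- enum 'I_n.+1 & (a.+1 < n.+1)%N] = iota 0 n.
  rewrite -(filter_map val (fun a => a.+1 < n.+1)%N) val_enum_ord -addn1 iotaD.
  rewrite filter_cat /= addn1 ltnn cats0.
  by apply/all_filterP/allP => a; rewrite mem_iota add0n ltnS.
set s := [seq a <- _ | _] in E *.
have si : (i < size s)%N by rewrite -(size_map val) E size_iota; lia.
rewrite (nth_map i) //; congr f; apply/val_inj.
by rewrite -[LHS](nth_map i 0%N val) // E nth_iota //; lia.
Qed.

Section SparseRows.
Variables (R : realFieldType) (n : nat) (B : 'M[R]_n).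
Implicit Types (i j : 'I_n).

Lemma sp_colE i k : (k < sp_size B i)%N -> sp_col B i k = nth i (sp_cols B i) k.
Proof. by move=> kr; rewrite /sp_col (nth_map i). Qed.

Lemma sp_valE i k :
  (k < sp_size B i)%N -> sp_val B i k = B i (nth i (sp_cols B i) k).
Proof. by move=> kr; rewrite /sp_val (nth_map i). Qed.

Lemma sp_col_size i : sp_col B i (sp_size B i) = n.
Proof. by rewrite /sp_col nth_default ?size_map. Qed.

Lemma sp_col_lt_n i k : (k < sp_size B i)%N -> (sp_col B i k < n)%N.
Proof. by move=> kr; rewrite sp_colE. Qed.

Lemma sp_cols_sorted i : sorted ltn [seq nat_of_ord j | j <- sp_cols B i].
Proof.
rewrite sorted_map; apply: sorted_filter.
  by move=> ? ? ?; apply: ltn_trans.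
by have := iota_ltn_sorted 0 n; rewrite -val_enum_ord sorted_map.
Qed.

(** Position [k'] may be the sentinel, whose value n exceeds every column index. *)
Lemma sp_col_ltn i k k' :
  (k < k')%N -> (k' <= sp_size B i)%N -> (sp_col B i k < sp_col B i k')%N.
Proof.
move=> kk'; rewrite leq_eqVlt => /predU1P[k'r|k'r].
  by rewrite k'r sp_col_size sp_col_lt_n // -k'r.
apply: (sorted_ltn_nth ltn_trans _ (sp_cols_sorted i)) => //.
  by rewrite inE size_map (ltn_trans kk').
by rewrite inE size_map.
Qed.

Lemma sp_col_leq i k k' :
  (k <= k')%N -> (k' <= sp_size B i)%N -> (sp_col B i k <= sp_col B i k')%N.
Proof.
rewrite leq_eqVlt => /predU1P[-> //|kk' k'r].
by rewrite ltnW // sp_col_ltn.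
Qed.

Lemma sp_val_sum (i j0 : 'I_n) k : (k < sp_size B i)%N ->
  (sp_col B i k <= j0 < sp_col B i k.+1)%N ->
  \sum_(k' < k.+1) sp_val B i k' ^+ 2 = \sum_(j < n | (i <= j <= j0)%N) B i j ^+ 2.
Proof.
move=> kr /andP[kj0 j0k].
rewrite -(big_mkord xpredT (fun k' => sp_val B i k' ^+ 2)).
rewrite (big_nat_widen 0 k.+1 (sp_size B i)) //=.
(* Since the columns are sorted and [j0] lies in gap k, cutting the positions at k is the same as
   cutting the columns at [j0]. *)
transitivity (\sum_(0 <= k' < sp_size B i | (nth i (sp_cols B i) k' <= j0)%N)
                B i (nth i (sp_cols B i) k') ^+ 2).
  apply: congr_big_nat => // k' /= k'r; last by rewrite sp_valE //; lia.
  rewrite -sp_colE ?ltnS; last by lia.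
  apply/idP/idP => h.
    by apply: leq_trans kj0; apply: sp_col_leq => //; lia.
  rewrite leqNgt; apply/negP => kk'.
  have : (sp_col B i k.+1 <= sp_col B i k')%N by apply: sp_col_leq; lia.
  lia.
rewrite -(big_nth i (fun j : 'I_n => (j <= j0)%N) (fun j => B i j ^+ 2)).
rewrite big_filter_cond big_enum_cond [LHS]big_mkcond [RHS]big_mkcond.
apply: eq_bigr => j _; rewrite -andbA.
(* Unstored entries from the diagonal on are zero, so their squares can be added freely. *)
have [->|_] := eqVneq (B i j) 0; first by rewrite expr0n /= !if_same.
by [].
Qed.

Hypotheses (Btr : B^T = B) (Bpsd : psdmx B).

(** Positive semidefiniteness enters here: a zero diagonal entry forces its whole row to vanish. *)
Lemma sp_size0 i : (sp_size B i == 0%N) = (B i i == 0).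
Proof.
rewrite /sp_size size_eq0; apply/eqP/eqP => [s0|Bii].
  apply/eqP/negPn/negP => Bii.
  have : i \in sp_cols B i by rewrite mem_filter leqnn Bii mem_enum.
  by rewrite s0.
apply/eqP; rewrite -(negbK (_ == _)) -has_filter.
apply/negP => /hasP[j _ /andP[_]].
by rewrite (psd_diag_eq0 Btr Bpsd) ?eqxx.
Qed.

(** The diagonal column is stored, no stored column precedes it, and the list is sorted. *)
Lemma sp_cols_head i : B i i != 0 -> nth i (sp_cols B i) 0 = i.
Proof.
move=> Bii; have r0 : (0 < sp_size B i)%N by rewrite lt0n sp_size0.
have iin : i \in sp_cols B i by rewrite mem_filter leqnn Bii mem_enum.
have ei : sp_col B i (index i (sp_cols B i)) = i.
  by rewrite sp_colE ?index_mem // nth_index.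
apply/val_inj/eqP; rewrite /= eqn_leq; apply/andP; split.
  rewrite -(sp_colE r0) -[leqRHS]ei.
  by rewrite sp_col_leq // ltnW ?index_mem.
by have := mem_nth i r0; rewrite mem_filter => /andP[/andP[]].
Qed.

Lemma sp_val0 i : sp_val B i 0 = B i i.
Proof.
have [Bii|Bii] := eqVneq (B i i) 0.
  move/eqP: (Bii); rewrite -sp_size0 => /eqP r0.
  by rewrite /sp_val nth_default ?size_map // -/(sp_size B i) r0.
by rewrite sp_valE ?sp_cols_head // lt0n sp_size0.
Qed.

Lemma sp_col0 i : B i i != 0 -> sp_col B i 0 = i.
Proof. by move=> Bii; rewrite sp_colE ?sp_cols_head // lt0n sp_size0. Qed.

(* Vanishes on and below the diagonal, so that summing over all (i, j) counts
   every pair {i, j} once. *)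
Definition pair_wt i j : R := if (i < j)%N then minor2 B i j else 0.

Lemma pair_wt_ge0 i j : 0 <= pair_wt i j.
Proof. by rewrite /pair_wt; case: ifP; rewrite ?minor2_ge0. Qed.

Lemma pair_wt_diag0 i j : B i i = 0 -> pair_wt i j = 0.
Proof.
move=> Bii; rewrite /pair_wt /minor2 Bii (psd_diag_eq0 Btr Bpsd j Bii).
by rewrite mul0r expr0n subrr if_same.
Qed.

(** * Closed forms of the precomputed tables *)

Section Preprocess.
Variables (h : seq (seq R)) (t q : seq R).
Hypothesis (Hpre : sparse2vs_preprocess B = (h, t, q)).

Lemma pre_h i k : (i.+1 < n)%N -> (k < sp_size B i)%N ->
  (nth [::] h i)`_k = \sum_(k' < k.+1) sp_val B i k' ^+ 2.
Proof.
move=> i_n kr; case: Hpre => <- _ _.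
rewrite (nth_enum_belast [::] (fun i : 'I_n =>
  [seq \sum_(k' < k.+1) sp_val B i k' ^+ 2 | k <- iota 0 (sp_size B i)])) //.
by rewrite (nth_map 0%N) ?size_iota // nth_iota.
Qed.

Lemma pre_t (m : nat) : (m <= n)%N -> t`_m = \sum_(j < n | (m <= j)%N) B j j.
Proof.
move=> mn; case: Hpre => _ <- _.
rewrite nth_rcons size_map size_enum_ord; case: ltnP => mn'.
  rewrite (nth_map (Ordinal mn')) ?size_enum_ord //.
  apply: eq_big => j; last by rewrite sp_val0.
  by rewrite nth_enum_ord.
(* At m = n the appended entry is 0, and the sum on the right is empty. *)
rewrite if_same big1 // => j; have := ltn_ord j; lia.
Qed.

Lemma pre_P (i j : 'I_n) k : (i.+1 < n)%N -> (k < sp_size B i)%N ->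
  (sp_col B i k <= j < sp_col B i k.+1)%N ->
  sp_P B h t i j k = \sum_(j' < n | (j' <= j)%N) pair_wt i j'.
Proof.
move=> i_n kr hj; rewrite /sp_P.
have r0 : sp_size B i != 0%N by rewrite -lt0n (leq_ltn_trans _ kr).
have Bii : B i i != 0 by rewrite -sp_size0.
have ij : (i <= j)%N.
  case/andP: hj => hj _; apply: leq_trans hj.
  by rewrite -[leqLHS](sp_col0 Bii) sp_col_leq // ltnW.
rewrite (negbTE r0) sp_val0 (pre_h i_n kr) (sp_val_sum kr hj).
rewrite !pre_t //; last exact: ltnW.
(* Splitting the tail sum from i at column j cancels the tail from j+1 and leaves the diagonal
   entries from i to j. *)
rewrite [X in X - \sum_(_ < n | (j < _)%N) _](bigID (fun j' : 'I_n => j' <= j)%N) /=.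
rewrite [X in _ + X - _](eq_bigl (fun j' : 'I_n => j < j')%N) /=; last by move=> j'; lia.
rewrite addrK mulr_sumr -sumrB [LHS]big_mkcond [RHS]big_mkcond.
apply: eq_bigr => j' _; rewrite /pair_wt /minor2.
(* Columns before i contribute to neither side; at [j' = i] the term is [B i i] squared minus
   itself, matching the zero weight on the diagonal. *)
case: (ltngtP i j') => [ij'|ij'|/val_inj <-] //=; first by rewrite if_same.
by rewrite if_same; case: ifP => _ //; rewrite -expr2 subrr.
Qed.

Lemma pre_P_last i : (i.+1 < n)%N ->
  sp_P_last B h t i = \sum_(j < n) pair_wt i j.
Proof.
move=> i_n; rewrite /sp_P_last.
have [Bii|Bii] := eqVneq (B i i) 0.
  rewrite /sp_P sp_size0 Bii eqxx big1 // => j _.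
  exact: pair_wt_diag0.
have r0 : (0 < sp_size B i)%N by rewrite lt0n sp_size0.
have nn : (n.-1 < n)%N by lia.
rewrite (@pre_P i (Ordinal nn)) //=; last 2 first.
- by rewrite prednK.
(* The last gap ends at the sentinel n, hence contains column n-1. *)
- rewrite (prednK r0) sp_col_size nn andbT.
  have : (sp_col B i (sp_size B i).-1 < n)%N by rewrite sp_col_lt_n ?prednK.
  lia.
by apply: eq_bigl => j; rewrite /=; have := ltn_ord j; lia.
Qed.

Lemma pre_q i : (i.+1 < n)%N ->
  q`_i = \sum_(i' < n | (i' <= i)%N) \sum_(j < n) pair_wt i' j.
Proof.
move=> i_n; case: (Hpre) => _ _ <-.
rewrite (nth_enum_belast 0 (fun i => \sum_(i' < n | (i' <= i)%N) sp_P_last B _ _ i')) //.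
case: (Hpre) => -> -> _.
by apply: eq_bigr => i' i'i; rewrite pre_P_last //; lia.
Qed.

Lemma pre_qlast : (1 < n)%N -> q`_n.-2 = \sum_(i < n) \sum_(j < n) pair_wt i j.
Proof.
move=> n1; have nn : (n.-2 < n)%N by lia.
rewrite (@pre_q (Ordinal nn)) /=; last by lia.
(* The last row is absent from [q], but no column lies beyond its diagonal, so its weights
   vanish. *)
rewrite big_mkcond; apply: eq_bigr => i _; case: leqP => // hi.
rewrite big1 // => j _; rewrite /pair_wt ltnNge.
by have -> : (j <= i)%N by have := ltn_ord j; lia.
Qed.
End Preprocess.
End SparseRows.

(** * Inversion of distribution functions *)

Lemma ord_min_first m (p : pred 'I_m) (a : 'I_m) :
  p a -> (forall b : 'I_m, (b < a)%N -> ~~ p b) -> ord_min p = Some a.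
Proof.
move=> pa amin; rewrite /ord_min.
have : a \in enum 'I_m by rewrite mem_enum.
have : sorted (fun x y : 'I_m => x < y)%N (enum 'I_m).
  by have := iota_ltn_sorted 0 m; rewrite -val_enum_ord sorted_map.
elim: (enum 'I_m) => [//|x s IHs] /= xs; rewrite inE => /predU1P[<-|ains].
  by rewrite pa.
rewrite ifN; first by apply: IHs => //; apply: path_sorted xs.
apply: amin; move: xs; rewrite path_sortedE; last by move=> ? ? ?; apply: ltn_trans.
by move=> /andP[/allP /(_ a ains)].
Qed.

Section Quantile.
Variables (R : realFieldType) (m : nat).
Implicit Types (w : 'I_m -> R) (a b : 'I_m) (u : R).

Definition total_wt w : R := \sum_(j < m) w j.
(** With [cumle], the left limit and the value at a of the distribution function proportional to
    [w]; both are 0 when the total weight is 0. *)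
Definition cumlt w a : R := (\sum_(j < m | (j < a)%N) w j) / total_wt w.
Definition cumle w a : R := (\sum_(j < m | (j <= a)%N) w j) / total_wt w.

Variable w : 'I_m -> R.
Hypothesis w_ge0 : forall j, 0 <= w j.

Lemma total_wt_ge0 : 0 <= total_wt w.
Proof. exact: sumr_ge0. Qed.

Lemma cumle_sub a : cumle w a - cumlt w a = w a / total_wt w.
Proof.
rewrite /cumle /cumlt (bigD1 a) //= -mulrBl; congr (_ / _).
rewrite [X in _ - X](eq_bigl (fun j : 'I_m => (j <= a)%N && (j != a))) ?addrK //.
by move=> j; rewrite ltn_neqAle andbC.
Qed.

Lemma cumlt_ge0 a : 0 <= cumlt w a.
Proof. by rewrite divr_ge0 ?total_wt_ge0 ?sumr_ge0. Qed.

Lemma cumlt_le a : cumlt w a <= cumle w a.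
Proof. by rewrite -subr_ge0 cumle_sub divr_ge0 ?total_wt_ge0. Qed.

Lemma sum_subset_le (P Q : pred 'I_m) : subpred P Q ->
  \sum_(j | P j) w j <= \sum_(j | Q j) w j.
Proof.
move=> PQ; rewrite [leLHS]big_mkcond [leRHS]big_mkcond; apply: ler_sum => j _.
by case: (boolP (P j)) => [/PQ -> //|_]; case: ifP.
Qed.

Lemma cumle_le1 a : cumle w a <= 1.
Proof.
have [W0|W0] := eqVneq (total_wt w) 0; first by rewrite /cumle W0 invr0 mulr0.
rewrite ler_pdivrMr ?mul1r; first exact: sum_subset_le.
by rewrite lt0r W0 total_wt_ge0.
Qed.

Lemma cumle_mono a b : (a <= b)%N -> cumle w a <= cumle w b.
Proof.
move=> ab; rewrite ler_wpM2r ?invr_ge0 ?total_wt_ge0 // sum_subset_le // => j /=.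
by move=> ja; apply: leq_trans ab.
Qed.

Lemma cumle_lt a b : (a < b)%N -> cumle w a <= cumlt w b.
Proof.
move=> ab; rewrite ler_wpM2r ?invr_ge0 ?total_wt_ge0 // sum_subset_le // => j /=.
by move=> ja; apply: leq_ltn_trans ab.
Qed.

(** The values u for which inversion yields a. The right end is closed because the searches test
    with a non-strict inequality. *)
Definition quantile u a := cumlt w a < u <= cumle w a.

(** The interval contains u, so its length [w a / total_wt w] is positive. *)
Lemma quantile_wt_gt0 u a : quantile u a -> 0 < w a.
Proof.
move=> /andP[lo hi]; have := lt_le_trans lo hi.
rewrite -subr_gt0 cumle_sub lt0r => /andP[+ _].
by rewrite mulf_eq0 negb_or => /andP[wa _]; rewrite lt0r wa w_ge0.
Qed.

Lemma quantile_total_gt0 u a : quantile u a -> 0 < total_wt w.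
Proof.
move=> /quantile_wt_gt0 wa; apply: lt_le_trans wa _.
by rewrite /total_wt (bigD1 a) //= lerDl sumr_ge0.
Qed.

(** Turns each test made by a search into a comparison of indices. *)
Lemma quantile_le u a b : quantile u a -> (u <= cumle w b) = (a <= b)%N.
Proof.
move=> /andP[lo hi]; apply/idP/idP => [|ab]; last exact: le_trans (cumle_mono ab).
apply: contraLR; rewrite -ltnNge -ltNge => ba.
by apply: le_lt_trans lo; apply: cumle_lt.
Qed.

(** The least index whose [cumle] reaches u works: [cumle] is 1 at the last index, and [cumlt] at a
    positive index is [cumle] at its predecessor. *)
Lemma quantile_exists u : 0 < total_wt w -> 0 < u < 1 -> exists a, quantile u a.
Proof.
move=> W0 /andP[u0 u1].
have [m0|m0] := posnP m.
  by move: W0; rewrite /total_wt big1 ?ltxx // => j; have := ltn_ord j; rewrite {2}m0.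
have mm : (m.-1 < m)%N by rewrite prednK.
have hmax : u <= cumle w (Ordinal mm).
  rewrite /cumle (eq_bigl xpredT) ?divff ?gt_eqF ?ltW //.
  by move=> j /=; have := ltn_ord j; lia.
case: (@arg_minnP _ (Ordinal mm) (fun a => u <= cumle w a) (fun a => a)) => // a ua amin.
exists a; rewrite /quantile ua andbT.
have [a0|a0] := posnP a.
  by rewrite /cumlt big1 ?mul0r // => j; rewrite a0.
have aa : (a.-1 < m)%N by have := ltn_ord a; lia.
rewrite ltNge; apply/negP => ulo.
have /amin : u <= cumle w (Ordinal aa).
  rewrite (le_trans ulo) // /cumlt /cumle.
  by rewrite (eq_bigl (fun j : 'I_m => j <= a.-1)%N) // => j; lia.
rewrite /=; lia.
Qed.
End Quantile.

(** * The outcome of a run for fixed values of the two uniform variables *)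

Section Sample.
Variables (R : realFieldType) (n : nat) (B : 'M[R]_n).
Hypotheses (Btr : B^T = B) (Bpsd : psdmx B).
Variables (h : seq (seq R)) (t q : seq R).
Hypothesis (Hpre : sparse2vs_preprocess B = (h, t, q)).

Definition row_wt (i : 'I_n) : R := total_wt (pair_wt B i).

Lemma row_wt_ge0 i : 0 <= row_wt i.
Proof. by apply: total_wt_ge0 => j; apply: pair_wt_ge0. Qed.

Lemma pair_wt_gt0_lt i j : 0 < pair_wt B i j -> (i < j)%N.
Proof. by rewrite /pair_wt; case: ifP; rewrite ?ltxx. Qed.

(** By [quantile_le], the three searches look for the first row not before [i0], the first gap not
    ending before [j0], and the first column of that gap not before [j0]. *)
Lemma sample_quantile u1 u2 i0 j0 :
  quantile row_wt u1 i0 -> quantile (pair_wt B i0) u2 j0 ->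
  sparse2vs_sample B h t q u1 u2 = Some [set i0; j0].
Proof.
move=> Q1 Q2.
have w_ge0 := pair_wt_ge0 Btr Bpsd.
have Wpos := quantile_total_gt0 row_wt_ge0 Q1.
have Wi0 : 0 < row_wt i0 := quantile_wt_gt0 row_wt_ge0 Q1.
have ij : (i0 < j0)%N := pair_wt_gt0_lt (quantile_wt_gt0 (w_ge0 i0) Q2).
have i0n : (i0.+1 < n)%N by have := ltn_ord j0; lia.
rewrite /sparse2vs_sample (pre_qlast Btr Bpsd Hpre); last by lia.
rewrite -/(total_wt row_wt) gt_eqF //.
rewrite (@ord_min_first _ _ i0); first last.
- move=> b bi0; rewrite (pre_q Btr Bpsd Hpre); last by lia.
  by rewrite (quantile_le row_wt_ge0 b Q1) negb_and -[X in _ || X]ltnNge bi0 orbT.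
- rewrite i0n (pre_q Btr Bpsd Hpre) //=.
  by rewrite (quantile_le row_wt_ge0 i0 Q1).
rewrite (pre_P_last Btr Bpsd Hpre) // -/(total_wt (pair_wt B i0)) -/(row_wt i0) gt_eqF //.
have Bii : B i0 i0 != 0.
  apply: contraTneq Wi0 => Bii; rewrite /row_wt /total_wt big1 ?ltxx // => j _.
  exact: pair_wt_diag0.
have r0 : (0 < sp_size B i0)%N by rewrite lt0n sp_size0.
have [kl kl_j0] : exists kl : 'I_(sp_size B i0),
    (sp_col B i0 kl <= j0 < sp_col B i0 kl.+1)%N.
  have c0 : (sp_col B i0 (Ordinal r0) <= j0)%N by rewrite sp_col0 // ltnW.
  (* The gap containing [j0] starts at the last stored column not beyond [j0]; position 0 qualifies,
     since its column is [i0]. *)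
  case: (@arg_maxnP _ (Ordinal r0)
           (fun k : 'I_(sp_size B i0) => sp_col B i0 k <= j0)%N (fun k => k) c0)
    => k kj0 kmax.
  exists k; rewrite kj0 /= ltnNge; apply/negP => k1j0.
  have k1 : (k.+1 < sp_size B i0)%N.
    rewrite ltn_neqAle ltn_ord andbT; apply/eqP => e.
    by move: k1j0; rewrite e sp_col_size leqNgt ltn_ord.
  by have := kmax (Ordinal k1) k1j0; rewrite /= ltnn.
have P_last_col (k : 'I_(sp_size B i0)) :
    (u2 <= sp_P B h t i0 (sp_col B i0 k.+1).-1 k / row_wt i0)
    = (j0 <= (sp_col B i0 k.+1).-1)%N.
  have cn : ((sp_col B i0 k.+1).-1 < n)%N.
    have := sp_col_leq (ltn_ord k) (leqnn _); rewrite sp_col_size; lia.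
  have ck := sp_col_ltn (ltnSn k) (ltn_ord k).
  rewrite -[X in sp_P _ _ _ _ X]/(nat_of_ord (Ordinal cn)) (pre_P Btr Bpsd Hpre) //.
    by rewrite (quantile_le (w_ge0 i0) (Ordinal cn) Q2).
  by rewrite /=; lia.
rewrite (@ord_min_first _ _ kl); first last.
- move=> k kkl; rewrite P_last_col -ltnNge.
  have := sp_col_leq kkl (ltnW (ltn_ord kl)).
  have := sp_col_ltn (ltnSn k) (ltn_ord k).
  by case/andP: kl_j0; lia.
- by rewrite P_last_col; case/andP: kl_j0; lia.
have P_j (j : 'I_n) : (sp_col B i0 kl <= j < sp_col B i0 kl.+1)%N ->
    (u2 <= sp_P B h t i0 j kl / row_wt i0) = (j0 <= j)%N.
  move=> hj; rewrite (pre_P Btr Bpsd Hpre) //.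
  by rewrite (quantile_le (w_ge0 i0) j Q2).
rewrite (@ord_min_first _ _ j0) //.
  by rewrite P_j ?kl_j0 ?leqnn.
move=> j jj0; apply/negP => /andP[hj]; rewrite P_j //; lia.
Qed.

Lemma total_row_wt :
  total_wt row_wt =
  \sum_(S : {set 'I_n} | #|S| == 2) \det (principal_submx B S).
Proof.
rewrite sum_card2; apply: eq_bigr => i _; rewrite [RHS]big_mkcond.
apply: eq_bigr => j _; rewrite /pair_wt; case: ifP => // ij.
by rewrite det_principal2 ?(sym_entry Btr i) // neq_ltn ij.
Qed.

Lemma vol2_pair (i j : 'I_n) : (i < j)%N ->
  vol2 B [set i; j] = pair_wt B i j / total_wt row_wt.
Proof.
move=> ij; rewrite /vol2 total_row_wt /pair_wt ij.
by rewrite det_principal2 ?(sym_entry Btr i) // neq_ltn ij.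
Qed.

Lemma total_row_wt_gt0 : (2 <= \rank B)%N -> 0 < total_wt row_wt.
Proof.
move=> /(psd_rank2_minor Btr Bpsd)[i [j m0]].
(* Minors are symmetric and vanish on the diagonal, so the nonzero one can be taken above it. *)
wlog ij : i j m0 / (i < j)%N.
  move=> W; case: (ltngtP i j) => [|ji|/val_inj e]; first exact: W.
    by apply: (W j i) => //; rewrite (minor2C Btr).
  by move: m0; rewrite e minor2_diag eqxx.
have w0 : 0 < pair_wt B i j.
  by rewrite /pair_wt ij lt0r m0 minor2_ge0.
apply: lt_le_trans w0 _; apply: (@le_trans _ _ (row_wt i)).
  rewrite /row_wt /total_wt (bigD1 j) //= lerDl sumr_ge0 // => k _.
  exact: pair_wt_ge0.
by rewrite /total_wt (bigD1 i) //= lerDl sumr_ge0 // => k _; apply: row_wt_ge0.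
Qed.

Lemma sample_exists u1 u2 : (2 <= \rank B)%N -> 0 < u1 < 1 -> 0 < u2 < 1 ->
  exists i0 j0 : 'I_n, [/\ (i0 < j0)%N, quantile row_wt u1 i0 &
    quantile (pair_wt B i0) u2 j0].
Proof.
move=> /total_row_wt_gt0 W0 hu1 hu2; have w_ge0 := pair_wt_ge0 Btr Bpsd.
have [i0 Q1] := quantile_exists W0 hu1.
have [j0 Q2] := quantile_exists (quantile_wt_gt0 row_wt_ge0 Q1) hu2.
exists i0, j0; split=> //.
exact: pair_wt_gt0_lt (quantile_wt_gt0 (w_ge0 i0) Q2).
Qed.

(** For the forward direction, some increasing pair has quantile intervals containing u1 and u2; the
    run returns its set, which determines the pair. *)
Lemma sample_pairP u1 u2 (a b : 'I_n) : (2 <= \rank B)%N ->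
  0 < u1 < 1 -> 0 < u2 < 1 -> (a < b)%N ->
  sparse2vs_sample B h t q u1 u2 = Some [set a; b] <->
  quantile row_wt u1 a /\ quantile (pair_wt B a) u2 b.
Proof.
move=> rkB hu1 hu2 ab; split=> [|[Q1 Q2]]; last exact: sample_quantile.
have [i0 [j0 [ij Q1 Q2]]] := sample_exists rkB hu1 hu2.
rewrite (sample_quantile Q1 Q2) => -[/(@set2_lt_inj _ (i0, j0) (a, b) ij ab)].
by case=> <- <-.
Qed.
End Sample.

Local Open Scope classical_set_scope.
Local Open Scope ring_scope.

(** * The law of the sample *)

Section DiscreteMeasurability.
Context {d : measure_display} {Omega : measurableType d}.

(** Measurability into the discrete sigma-algebra, for targets that carry no measurable
    structure. *)
Definition discretely_measurable (T : Type) (g : Omega -> T) : Prop :=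
  forall A : set T, measurable (g @^-1` A).

Lemma discretely_measurable_cst (T : Type) (x : T) :
  discretely_measurable (fun=> x).
Proof. by move=> A; rewrite preimage_cst; case: ifP. Qed.

(** The preimage splits over the finitely many values of [g]. This follows control flow: the result
    of a search selects the rest of the run. *)
Lemma discretely_measurable_bind (I : finType) (T : Type) (g : Omega -> I)
    (f : I -> Omega -> T) :
  discretely_measurable g -> (forall i, discretely_measurable (f i)) ->
  discretely_measurable (fun w => f (g w) w).
Proof.
move=> mg mf A.
have -> : (fun w => f (g w) w) @^-1` A =
    \bigcup_(i in [set: I]) (g @^-1` [set i] `&` f i @^-1` A).
  by apply/seteqP; split=> [w Aw|w [i _ [/= <-]]//]; exists (g w).
apply: fin_bigcup_measurable => [|i _]; first exact: finite_finset.
by apply: measurableI; [exact: mg|exact: mf].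
Qed.

Lemma discretely_measurable_ord_min (m : nat) (p : Omega -> pred 'I_m) :
  (forall a, discretely_measurable (fun w => p w a)) ->
  discretely_measurable (fun w => ord_min (p w)).
Proof.
move=> mp; rewrite /ord_min; elim: (enum 'I_m) => [|a s IHs] /=.
  exact: discretely_measurable_cst.
(* Once the outcome c of the test at a is fixed, what remains is the constant [Some a] or the search
   in the tail. *)
pose f (c : bool) w :=
  ohead (let s' := [seq b <- s | p w b] in if c then a :: s' else s').
apply: (discretely_measurable_bind (f := f) (mp a)) => -[]; last exact: IHs.
exact: (discretely_measurable_cst (Some a)).
Qed.

Lemma discretely_measurable_le (R : realType) (u : Omega -> R) (c : R) :
  measurable_fun setT u -> discretely_measurable (fun w => u w <= c).
Proof.
move=> mu A; rewrite -[X in measurable X]setTI.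
exact: (measurable_fun_ler mu (measurable_cst c)).
Qed.

Lemma discretely_measurable_sample (R : realType) (n : nat) (B : 'M[R]_n)
    (h : seq (seq R)) (t q : seq R) (u1 u2 : Omega -> R) :
  measurable_fun setT u1 -> measurable_fun setT u2 ->
  discretely_measurable (fun w => sparse2vs_sample B h t q (u1 w) (u2 w)).
Proof.
move=> mu1 mu2.
have mand (b : bool) (u : Omega -> R) (c : R) : measurable_fun setT u ->
    discretely_measurable (fun w => b && (u w <= c)).
  move=> mu; case: b; first exact: discretely_measurable_le.
  exact: discretely_measurable_cst.
rewrite /sparse2vs_sample; case: eqP => _; first exact: discretely_measurable_cst.
apply: (discretely_measurable_bind (f := fun o w => if o is Some i0 then _ else None)).
  by apply: discretely_measurable_ord_min => a; apply: mand.
move=> [i0|]; last exact: discretely_measurable_cst.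
rewrite /=; case: eqP => _; first exact: discretely_measurable_cst.
apply: (discretely_measurable_bind (f := fun o w => if o is Some kl then _ else None)).
  by apply: discretely_measurable_ord_min => a; apply: discretely_measurable_le.
move=> [kl|]; last exact: discretely_measurable_cst.
apply: (discretely_measurable_bind (f := fun o w => if o is Some j0 then _ else None)).
  by apply: discretely_measurable_ord_min => a; apply: mand.
by move=> [j0|]; apply: discretely_measurable_cst.
Qed.

End DiscreteMeasurability.

(** * Uniform variables on intervals, and null sets *)

Section Uniform.
Context {d : measure_display} {Omega : measurableType d} {R : realType}.
Variable Pr : probability Omega R.

Lemma uniform_prob_itv (b c : bool) (x y : R) : 0 <= x -> x <= y -> y <= 1 ->
  uniform_prob (@ltr01 R) [set` Interval (BSide b x) (BSide c y)] = (y - x)%:E.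
Proof.
move=> x0 xy y1; set I := [set` _]; rewrite /uniform_prob.
have mI : measurable I by exact: measurable_itv.
have IE : forall z, I z -> 0 <= z <= 1.
  move=> z; rewrite /I /= in_itv /= => /andP[/lteifW xz /lteifW zy].
  by rewrite (le_trans x0 xz) (le_trans zy y1).
rewrite (eq_integral (cst 1%E)); last first.
  by move=> z /set_mem /IE z01; rewrite /uniform_pdf z01 subr0 invr1.
rewrite integral_cst // mul1e /I /= lebesgue_measure_itv /= lte_fin.
(* A degenerate interval has measure 0, whichever ends it includes. *)
case: ltP => [//|yx]; have -> : x = y by apply/eqP; rewrite eq_le xy.
by rewrite subrr.
Qed.

Lemma uniform01_itv (u : {RV Pr >-> R}) (b c : bool) (x y : R) :
  uniform01 u -> 0 <= x -> x <= y -> y <= 1 ->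
  Pr (u @^-1` [set` Interval (BSide b x) (BSide c y)]) = (y - x)%:E.
Proof.
move=> Hu x0 xy y1; rewrite -(uniform_prob_itv b c x0 xy y1).
exact: (Hu _ (measurable_itv _)).
Qed.

Lemma uniform01_outside (u : {RV Pr >-> R}) : uniform01 u ->
  Pr (~` (u @^-1` `]0, 1[)) = 0%E.
Proof.
move=> Hu; rewrite probability_setC; last exact: measurable_funPTI.
rewrite uniform01_itv ?subr0 ?ler01 //.
by rewrite subee.
Qed.

Lemma prob_eq_mod_null (A E N : set Omega) : measurable A -> measurable E ->
  measurable N -> Pr N = 0%E -> A `|` N = E `|` N -> Pr A = Pr E.
Proof.
by move=> mA mE mN N0 AE; rewrite -(measureU0 mA mN N0) AE measureU0.
Qed.

End Uniform.

Theorem theorem4p2 (R : realType) (n : nat) (B : 'M[R]_n)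
    (Bsym : B \is symmetricmx) (Bpsd : psdmx B) (Brank : (2 <= \rank B)%N)
    (h : seq (seq R)) (t q : seq R)
    (Hpre : sparse2vs_preprocess B = (h, t, q))
    (d : measure_display) (Omega : measurableType d) (Pr : probability Omega R)
    (u1 u2 : {RV Pr >-> R})
    (Hu1 : uniform01 u1) (Hu2 : uniform01 u2) (Hu : independent2 u1 u2) :
  let S0 := fun w : Omega => sparse2vs_sample B h t q (u1 w) (u2 w) in
  [/\ forall w : Omega, 0 < u1 w < 1 -> 0 < u2 w < 1 ->
        exists2 S : {set 'I_n}, S0 w = Some S & #|S| = 2%N,
      forall A : set (option {set 'I_n}), measurable (S0 @^-1` A)
    & forall S : {set 'I_n}, #|S| = 2%N ->
        Pr (S0 @^-1` [set Some S]) = (vol2 B S)%:E].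
Proof.
have Btr : B^T = B.
  by move/is_hermitianmxP: Bsym; rewrite expr0 scale1r map_mx_id.
move=> S0; have mS0 : discretely_measurable S0 by exact: discretely_measurable_sample.
split=> [w hu1 hu2||S /card2_lt[a [b [ab ->]]]].
- have [i0 [j0 [ij Q1 Q2]]] := sample_exists Btr Bpsd Brank hu1 hu2.
  exists [set i0; j0]%SET; first exact: sample_quantile.
  by rewrite cards2 neq_ltn ij.
- exact: mS0.
have w_ge0 := pair_wt_ge0 Btr Bpsd; have W_ge0 := row_wt_ge0 Btr Bpsd.
(* Off the null set [N], where some u leaves the open unit interval, the event is the rectangle [E1]
   times [E2]; independence then multiplies the two interval lengths. *)
pose I1 := `]cumlt (row_wt B) a, cumle (row_wt B) a].
pose I2 := `]cumlt (pair_wt B a) b, cumle (pair_wt B a) b].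
pose E1 := u1 @^-1` [set` I1]; pose E2 := u2 @^-1` [set` I2].
pose N := ~` (u1 @^-1` `]0, 1[) `|` ~` (u2 @^-1` `]0, 1[).
have good w : ~ N w -> 0 < u1 w < 1 /\ 0 < u2 w < 1.
  by move=> /not_orP[/contrapT + /contrapT]; rewrite /= !in_itv.
have mN1 : measurable (~` (u1 @^-1` `]0, 1[)).
  by apply: measurableC; exact: measurable_funPTI.
have mN2 : measurable (~` (u2 @^-1` `]0, 1[)).
  by apply: measurableC; exact: measurable_funPTI.
have mE1 : measurable E1 by exact: measurable_funPTI.
have mE2 : measurable E2 by exact: measurable_funPTI.
rewrite (@prob_eq_mod_null _ _ _ _ _ (E1 `&` E2) N) //; first last.
- apply/seteqP; split=> w [Sw|Nw]; try by right.
    have [Nw|/good[hu1 hu2]] := pselect (N w); [by right|left].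
    have [Q1 Q2] := (sample_pairP Btr Bpsd Hpre Brank hu1 hu2 ab).1 Sw.
    by split; rewrite /E1 /E2 /= in_itv.
  have [Nw|/good[hu1 hu2]] := pselect (N w); [by right|left].
  apply/(sample_pairP Btr Bpsd Hpre Brank hu1 hu2 ab).
  by case: Sw; rewrite /E1 /E2 /= !in_itv.
- by rewrite measureU0 //; exact: uniform01_outside.
- exact: measurableU.
- exact: measurableI.
rewrite Hu //.
rewrite !uniform01_itv ?cumlt_ge0 ?cumlt_le ?cumle_le1 //.
rewrite !cumle_sub -EFinM vol2_pair //; congr (_%:E).
(* The row weight cancels from the product of lengths unless it is 0; then every weight of the row
   is 0 and both sides vanish. *)
have [W0|W0] := eqVneq (row_wt B a) 0.
  rewrite W0 !mul0r; have /eqP := W0.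
  rewrite psumr_eq0 // => /allP/(_ b); rewrite mem_index_enum => /(_ isT) /eqP ->.
  by rewrite mul0r.
by rewrite [LHS]mulrC mulrA divfK.
Qed.
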